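(* Let $G\in\mathbb{R}^{m\times n}$ have full row rank, let $b_1,b_2\in\mathbb{R}^m$ be constant vectors, and consider the two closed convex sets $C_1=\{x\in\mathbb{R}^n: Gx\le b_1\}$ and $C_2=\{x\in\mathbb{R}^n: Gx\le b_2\}$. Then for every $y\in\mathbb{R}^n$, $$\left\|P_{C_1}(y)-P_{C_2}(y)\right\|\le \frac{\|b_1-b_2\|}{\sqrt{\lambda_{\min}(GG^{\mathrm T})}}.$$
   Context: $\mathbb{R}^n$ carries the standard inner product and the Euclidean norm $\|\cdot\|$. Vector inequalities are componentwise. For a closed convex set $C\subseteq\mathbb{R}^n$, $P_C(y)=\arg\min_{x\in C}\frac12\|x-y\|^2$ is the Euclidean projection of $y$ onto $C$. For a positive definite matrix $Q$, $\lambda_{\min}(Q)$ is its smallest eigenvalue. *)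

(* Defs.v *)
From HB Require Import structures.
From mathcomp Require Import all_boot all_order all_algebra.
From mathcomp Require Import boolp classical_sets reals.
Set Implicit Arguments.
Unset Strict Implicit.
Unset Printing Implicit Defensive.
Import Order.TTheory GRing.Theory Num.Theory.
Local Open Scope classical_set_scope.
Local Open Scope ring_scope.

(* The norm that MathComp-Analysis puts on matrices is the sup norm, hence this
   separate definition of the Euclidean one. *)
Definition enorm (R : realType) (n : nat) (x : 'cV[R]_n) : R :=
  Num.sqrt (\sum_(i < n) x i 0 ^+ 2).

Definition vle (R : realType) (m : nat) (u v : 'cV[R]_m) : Prop :=
  forall i : 'I_m, u i 0 <= v i 0.

Definition polyhedron (R : realType) (m n : nat) (G : 'M[R]_(m, n))
    (b : 'cV[R]_m) : set 'cV[R]_n :=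
  [set x | vle (G *m x) b].

(* A minimizer of f over C; the default value 0 is taken only if there is none. *)
Definition argmin (R : realType) (n : nat) (C : set 'cV[R]_n)
    (f : 'cV[R]_n -> R) : 'cV[R]_n :=
  xget 0 [set x | C x /\ forall z, C z -> f x <= f z].

Definition proj (R : realType) (n : nat) (C : set 'cV[R]_n) (y : 'cV[R]_n) :
    'cV[R]_n :=
  argmin C (fun x => 2^-1 * enorm (x - y) ^+ 2).

(* The least element of the set of eigenvalues; the default value 0 is taken
   only if there is none. [eigenvalue] refers to row eigenvectors, which makes
   no difference to the spectrum. *)
Definition lambda_min (R : realType) (m : nat) (Q : 'M[R]_m) : R :=
  xget 0 ([set a | eigenvalue Q a] `&` lbound [set a | eigenvalue Q a]).

(* Main.v *)
(** A point [x = y - G^T l], with [l] a multiplier satisfying the KKT conditions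
    for [b], is the projection of [y] onto [{x | G x <= b}]; such an [l] minimizes
    the dual function [|G^T l|^2 / 2 + <l, b - G y>] over [l >= 0], which is
    coercive because [lambda_min (G G^T) > 0]. If [l1], [l2] are multipliers for
    [b1], [b2], complementary slackness gives
    [|x1 - x2|^2 <= <l2 - l1, b1 - b2>], while [x1 - x2 = G^T (l2 - l1)] has norm
    at least [sqrt (lambda_min (G G^T)) * |l2 - l1|]; Cauchy-Schwarz concludes. *)

Require Import Defs.
From mathcomp Require Import all_boot all_order all_algebra.
From mathcomp Require Import boolp classical_sets reals.
From mathcomp Require Import topology normedtype derive ring lra.
Import Order.TTheory GRing.Theory Num.Theory.
Import numFieldNormedType.Exports.
Local Open Scope ring_scope.

Section EuclideanSpace.
Set Implicit Arguments.
Unset Strict Implicit.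
Context {R : realType}.

(** * Inner product and Euclidean norm *)

Definition dot {n} (u v : 'cV[R]_n) : R := (u^T *m v) 0 0.

Lemma dotE n (u v : 'cV[R]_n) : dot u v = \sum_i u i 0 * v i 0.
Proof. by rewrite /dot mxE; apply: eq_bigr => i _; rewrite mxE. Qed.

Lemma dotC n (u v : 'cV[R]_n) : dot u v = dot v u.
Proof. by rewrite !dotE; apply: eq_bigr => i _; rewrite mulrC. Qed.

Lemma dotDl n (u v w : 'cV[R]_n) : dot (u + v) w = dot u w + dot v w.
Proof. by rewrite /dot linearD mulmxDl mxE. Qed.

Lemma dotZl n (a : R) (u v : 'cV[R]_n) : dot (a *: u) v = a * dot u v.
Proof. by rewrite /dot linearZ -scalemxAl mxE. Qed.

Lemma dotNl n (u v : 'cV[R]_n) : dot (- u) v = - dot u v.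
Proof. by rewrite -scaleN1r dotZl mulN1r. Qed.

Lemma dot0l n (u : 'cV[R]_n) : dot 0 u = 0.
Proof. by rewrite -(scale0r u) dotZl mul0r. Qed.

Lemma dotDr n (u v w : 'cV[R]_n) : dot u (v + w) = dot u v + dot u w.
Proof. by rewrite dotC dotDl !(dotC u). Qed.

Lemma dotZr n (a : R) (u v : 'cV[R]_n) : dot u (a *: v) = a * dot u v.
Proof. by rewrite dotC dotZl dotC. Qed.

Lemma dotNr n (u v : 'cV[R]_n) : dot u (- v) = - dot u v.
Proof. by rewrite dotC dotNl dotC. Qed.

Definition dot_linear := (dotDl, dotDr, dotNl, dotNr, dotZl, dotZr).

Lemma dot_delta n (u : 'cV[R]_n) i : dot u (delta_mx i 0) = u i 0.
Proof.
rewrite dotE (bigD1 i) //= mxE !eqxx mulr1 big1 ?addr0 // => j /negbTE ji.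
by rewrite mxE ji mulr0.
Qed.

Lemma dot_mulmxl m n (A : 'M[R]_(m, n)) u v : dot (A *m u) v = dot u (A^T *m v).
Proof. by rewrite /dot trmx_mul mulmxA. Qed.

Lemma dot_ge0 n (u : 'cV[R]_n) : 0 <= dot u u.
Proof. by rewrite dotE sumr_ge0 // => i _; rewrite -expr2 sqr_ge0. Qed.

Lemma dot_eq0 n (u : 'cV[R]_n) : (dot u u == 0) = (u == 0).
Proof.
apply/eqP/eqP => [|->]; last by rewrite dotE big1 // => i _; rewrite mxE mul0r.
rewrite dotE => /eqP; rewrite psumr_eq0 => [/allP u0|i _]; last first.
  by rewrite -expr2 sqr_ge0.
apply/colP => i; have := u0 i (mem_index_enum _).
by rewrite mulf_eq0 orbb mxE => /eqP.
Qed.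

Lemma dot_gt0 n (u : 'cV[R]_n) : (0 < dot u u) = (u != 0).
Proof. by rewrite lt_neqAle dot_ge0 andbT eq_sym dot_eq0. Qed.

Lemma enormE n (u : 'cV[R]_n) : enorm u = Num.sqrt (dot u u).
Proof. by rewrite dotE. Qed.

Lemma enorm_ge0 n (u : 'cV[R]_n) : 0 <= enorm u.
Proof. exact: sqrtr_ge0. Qed.

Lemma sqr_enorm n (u : 'cV[R]_n) : enorm u ^+ 2 = dot u u.
Proof. by rewrite enormE sqr_sqrtr ?dot_ge0. Qed.

Lemma enorm_coord n (u : 'cV[R]_n) i : `|u i 0| <= enorm u.
Proof.
rewrite -sqrtr_sqr; apply: ler_wsqrtr.
by rewrite (bigD1 i) //= lerDl sumr_ge0 // => j _; rewrite sqr_ge0.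
Qed.

Lemma cauchy_schwarz n (u v : 'cV[R]_n) : dot u v <= enorm u * enorm v.
Proof.
have [->|u0] := eqVneq u 0.
  by rewrite dot0l mulr_ge0 ?enorm_ge0.
have [->|v0] := eqVneq v 0.
  by rewrite dotC dot0l mulr_ge0 ?enorm_ge0.
have pu : 0 < enorm u by rewrite enormE sqrtr_gt0 dot_gt0.
have pv : 0 < enorm v by rewrite enormE sqrtr_gt0 dot_gt0.
(* This square expands to [2 * enorm u * enorm v * (enorm u * enorm v - dot u v)], and the factors
   in front are positive. *)
have := dot_ge0 (enorm v *: u - enorm u *: v).
rewrite !dot_linear (dotC v u) -!sqr_enorm => h.
rewrite -subr_ge0 -(pmulr_rge0 _ (mulr_gt0 pu pv)).
lra.
Qed.

(* First-order optimality condition in one direction. *)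
Lemma linear_term_ge0 (a c d : R) : 0 < d ->
  (forall t, 0 < t < d -> 0 <= t * a + t ^+ 2 * c) -> 0 <= a.
Proof.
move=> d0 h; rewrite leNgt; apply/negP => a0.
have p : 0 < `|c| + 1 by rewrite ltr_pwDr.
(* With [a < 0], the second bound gives [t * |c| < - a / 2], so the linear term wins; the [+ 1]
   covers [c = 0], and [d / 2] keeps [t] below [d]. *)
pose t := Num.min (d / 2) (- a / (2 * (`|c| + 1))).
have t0 : 0 < t by rewrite lt_min !divr_gt0 ?oppr_gt0 ?mulr_gt0.
have td : t < d by rewrite gt_min ltr_pdivrMr // ltr_pMr // ltr1n.
have : t <= - a / (2 * (`|c| + 1)) by rewrite ge_min lexx orbT.
rewrite ler_pdivlMr ?mulr_gt0 // => ta.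
have := h t; rewrite t0 td => /(_ isT).
rewrite expr2 -mulrA -mulrDr pmulr_rge0 // => h1.
have : t * c <= t * `|c| by rewrite ler_pM2l // ler_norm.
lra.
Qed.

(** * Continuity and compactness *)

Lemma trmx_continuous m n : continuous (@trmx R m n).
Proof.
move=> M s /= /(nbhs_ballP (M^T)) [e e0 es].
apply/nbhs_ballP; exists e => //= N [_ MN]; apply: es; split => // i j.
by rewrite !mxE; apply: MN.
Qed.

Lemma sum_continuous (T : topologicalType) n (f : 'I_n -> T -> R) :
  (forall i, continuous (f i)) -> continuous (fun x => \sum_i f i x).
Proof. by move=> cf; apply: continuous_big => //; apply: add_continuous. Qed.

Lemma dot_continuous m n (f g : 'cV[R]_m -> 'cV[R]_n) :
  (forall i, continuous (fun u => f u i 0)) ->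
  (forall i, continuous (fun u => g u i 0)) ->
  continuous (fun u => dot (f u) (g u)).
Proof.
move=> cf cg; under eq_fun do rewrite dotE.
apply: sum_continuous => i u.
exact: (cvgM (cf i u) (cg i u)).
Qed.

Lemma mulmx_continuous m n (A : 'M[R]_(n, m)) i :
  continuous (fun u : 'cV[R]_m => (A *m u) i 0).
Proof.
under eq_fun do rewrite mxE.
apply: sum_continuous => j u.
exact: (cvgM (cvg_cst (A i j)) (@coord_continuous _ _ _ j 0 u)).
Qed.

Lemma compact_box m (a b : R) :
  compact [set u : 'cV[R]_m | forall i, a <= u i 0 <= b]%classic.
Proof.
have -> : [set u : 'cV[R]_m | forall i, a <= u i 0 <= b]%classic =
    (@trmx R 1 m @` [set v : 'rV[R]_m |
                     forall i, `[a, b]%classic (v ord0 i)])%classic.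
  apply/seteqP; split => [u ub|_ [v vb <-] i]; last first.
    by have := vb i; rewrite mxE /= in_itv.
  by exists u^T; [move=> i /=; rewrite mxE in_itv; apply: ub|rewrite trmxK].
apply: continuous_compact; first exact/continuous_subspaceT/trmx_continuous.
by apply: (@rV_compact _ _ (fun=> `[a, b]%classic)) => i;
  apply: segment_compact.
Qed.

(** * The smallest eigenvalue as a minimal Rayleigh quotient *)

(** The quadratic form attains its minimum [mu] on the unit sphere, and a minimizer is an
    eigenvector. Hence [mu] is a least eigenvalue, and [lambda_min] is not its default value. *)
Lemma lambda_minP m (Q : 'M[R]_m) : Q^T = Q -> (0 < m)%N ->
  eigenvalue Q (lambda_min Q) /\
  forall x, lambda_min Q * dot x x <= dot (Q *m x) x.
Proof.
case: m Q => // m Q symQ _.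
have trQ (v : 'rV[R]_m.+1) a : v *m Q = a *: v <-> Q *m v^T = a *: v^T.
  split=> [vQ|Qv]; apply: trmx_inj.
    by rewrite trmx_mul trmxK symQ vQ linearZ /= trmxK.
  by rewrite trmx_mul symQ Qv linearZ.
(* The unit sphere, written as a closed part of a compact box. *)
pose S := ([set u : 'cV[R]_m.+1 | forall i, (-1 <= u i 0 <= 1)] `&`
           [set u | dot u u = 1])%classic.
have cS : compact S.
  apply: compact_closedI; first exact: compact_box.
  apply: (continuous_closedP (fun u : 'cV[R]_m.+1 => dot u u)).1 (@closed_eq _ 1).
  by apply: dot_continuous => i; apply: coord_continuous.
have inS u : dot u u = 1 -> S u.
  move=> u1; split=> // i; rewrite -ler_norml.
  by rewrite (le_trans (enorm_coord u i)) // enormE u1 sqrtr1.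
have S0 : (S !=set0)%classic.
  exists (delta_mx 0 0); apply: inS.
  by rewrite dot_delta mxE !eqxx.
have cQ : continuous (fun u => dot (Q *m u) u).
  by apply: dot_continuous => i; [apply: mulmx_continuous|apply: coord_continuous].
have [v] := compact_EVT_min S0 cS (continuous_subspaceT cQ).
rewrite inE => -[_ /= v1] minv; set mu := dot (Q *m v) v in minv.
have ray x : mu * dot x x <= dot (Q *m x) x.
  have [->|x0] := eqVneq x 0.
    by rewrite !(dotC _ 0) !dot0l mulr0.
  have p : 0 < dot x x by rewrite dot_gt0.
  have sx : enorm x ^+ 2 = dot x x by rewrite sqr_enorm.
  have ex : enorm x != 0 by rewrite -sqrf_eq0 sx gt_eqF.
  have := minv ((enorm x)^-1 *: x); rewrite inE => /(_ (inS _ _)).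
  rewrite -scalemxAr !dot_linear !mulrA -expr2 exprVn sx => /(_ _).
  by rewrite mulVf ?gt_eqF // ler_pdivlMl // mulrC; apply.
have symd u w : dot (Q *m u) w = dot (Q *m w) u.
  by rewrite dot_mulmxl symQ dotC.
have Qv : Q *m v = mu *: v.
  (* The Rayleigh inequality at [v - t w] has linear term [- 2 |w|^2] in [t]. *)
  apply/eqP; rewrite -subr_eq0; set w := _ - _.
  have ww : dot w w = dot (Q *m v) w - mu * dot v w by rewrite {1}/w dotDl dotNl dotZl.
  clearbody w; rewrite -dot_eq0 eq_le dot_ge0.
  rewrite andbT -oppr_ge0 -(pmulr_rge0 _ (ltr0n R 2)).
  apply: (@linear_term_ge0 _ (dot (Q *m w) w - mu * dot w w) 1) => // t _.
  have := ray (v - t *: w); rewrite mulmxBr -scalemxAr !dot_linear v1.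
  rewrite (symd w v) -/mu (dotC w v).
  nra.
have := @xgetPex _ 0 ([set a | eigenvalue Q a] `&`
                      lbound [set a | eigenvalue Q a])%classic.
rewrite -/(lambda_min Q).
have eigmu : eigenvalue Q mu.
  apply/eigenvalueP; exists v^T; first by apply/trQ; rewrite trmxK.
  by rewrite trmx_eq0 -dot_eq0 v1 oner_neq0.
case.
  exists mu; split=> //= a /eigenvalueP[u /trQ Qu u0].
  rewrite -trmx_eq0 -dot_gt0 in u0.
  (* At an eigenvector for [a], [ray] reads [mu * |u|^2 <= a * |u|^2]. *)
  by rewrite -(ler_pM2r u0) (le_trans (ray _)) // Qu dotZl.
move=> eiglam lelam; split=> // x.
by rewrite (le_trans _ (ray x)) // ler_wpM2r ?dot_ge0 ?lelam.
Qed.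

(** For an eigenvector [v], the eigenvalue times [|v|^2] is [|G^T v|^2], nonzero because full row
    rank makes [G^T] injective. *)
Lemma lambda_min_gram_gt0 m n (G : 'M[R]_(m, n)) : row_free G -> (0 < m)%N ->
  0 < lambda_min (G *m G^T).
Proof.
move=> Gfree m0.
have [|/eigenvalueP[v vGG v0] _] := @lambda_minP m (G *m G^T) _ m0.
  by rewrite trmx_mul trmxK.
have v0' := v0; rewrite -trmx_eq0 -dot_gt0 in v0'.
have GGv : G *m G^T *m v^T = lambda_min (G *m G^T) *: v^T.
  by apply: trmx_inj; rewrite !trmx_mul !trmxK vGG linearZ /= trmxK.
rewrite -(pmulr_lgt0 _ v0') -dotZl -GGv -mulmxA dot_mulmxl -trmx_mul.
rewrite dot_gt0 trmx_eq0.
by rewrite mulmx_free_eq0.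
Qed.

(** * KKT multipliers from the dual problem *)

(** Stationarity of the Lagrangian, [x - y + G^T l = 0], is built in by solving it for [x]. *)
Definition kkt_multiplier m n (G : 'M[R]_(m, n)) (b : 'cV[R]_m) (y : 'cV[R]_n)
    (l : 'cV[R]_m) : Prop :=
  let x := y - G^T *m l in
  forall i, [/\ 0 <= l i 0, (G *m x) i 0 <= b i 0 &
                l i 0 * (b - G *m x) i 0 = 0].

Lemma exists_kkt_multiplier m n (G : 'M[R]_(m, n)) b y :
  row_free G -> (0 < m)%N -> exists l, kkt_multiplier G b y l.
Proof.
move=> Gfree m0.
have lam0 := lambda_min_gram_gt0 Gfree m0.
have [|_ ray] := @lambda_minP m (G *m G^T) _ m0.
  by rewrite trmx_mul trmxK.
set lam := lambda_min _ in lam0 ray.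
pose q := b - G *m y.
pose f u := 2^-1 * dot (G^T *m u) (G^T *m u) + dot u q.
(* Since [f u >= |u| * (lam * |u| / 2 - |q|)], [f] is nonnegative, thus at least [f 0], once
   [|u| > M]. A minimizer over the box [B] is therefore one over the whole orthant. *)
pose M := 2 * enorm q / lam.
have M0 : 0 <= M by rewrite divr_ge0 ?mulr_ge0 ?enorm_ge0 ?ltW.
pose B := [set u : 'cV[R]_m | forall i, 0 <= u i 0 <= M]%classic.
have B0 : (B !=set0)%classic by exists 0 => i; rewrite mxE lexx.
have cf : continuous f.
  have cG : continuous (fun u => dot (G^T *m u) (G^T *m u)).
    by apply: dot_continuous => i; apply: mulmx_continuous.
  have cq : continuous (fun u => dot u q).
    apply: (dot_continuous (g := fun=> q)) => i; first exact: coord_continuous.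
    exact: cst_continuous.
  by move=> u; exact: (cvgD (cvgM (cvg_cst (2^-1 : R)) (cG u)) (cq u)).
have [l] := compact_EVT_min B0 (@compact_box m 0 M) (continuous_subspaceT cf).
rewrite inE => lB minl.
have {}minl (u : 'cV[R]_m) : (forall i, 0 <= u i 0) -> f l <= f u.
  move=> u0; have [uM|Mu] := leP (enorm u) M.
    apply: minl; rewrite inE => i; rewrite u0 /=.
    by rewrite (le_trans _ uM) // (le_trans (ler_norm _)) // enorm_coord.
  have fl0 : f l <= 0.
    apply: (le_trans (minl 0 _)); first by rewrite inE => i; rewrite mxE lexx.
    by rewrite /f mulmx0 !dot0l mulr0 addr0.
  apply: (le_trans fl0).
  have := ray u; rewrite -mulmxA dot_mulmxl -sqr_enorm.
  have := cauchy_schwarz (- u) q; rewrite dotNl.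
  have -> : enorm (- u) = enorm u by rewrite !enormE !dot_linear opprK.
  move: Mu; rewrite /M ltr_pdivrMr // /f => Mu.
  have := enorm_ge0 u; nra.
exists l => x i.
have [li0 _] := andP (lB i).
set w := (b - G *m x) i 0.
pose c := 2^-1 * dot (G^T *m delta_mx i 0) (G^T *m delta_mx i 0).
(* The partial derivative of the dual function at [l] is the slack [w] of the [i]-th constraint, so
   first-order optimality yields feasibility and complementary slackness. *)
have fD t : f (l + t *: delta_mx i 0) - f l = t * w + t ^+ 2 * c.
  have -> : w = dot (G^T *m l) (G^T *m delta_mx i 0) + dot (delta_mx i 0) q.
    rewrite -!dot_mulmxl mulmxA dot_delta (dotC _ q) dot_delta /w /x mulmxBr.
    by rewrite /q mulmxA !mxE; ring.
  rewrite /f /c mulmxDr -scalemxAr !dot_linear (dotC (_ *m delta_mx _ _) (_ *m l)).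
  by field.
have lD t j : (l + t *: delta_mx i 0) j 0 = l j 0 + t * (j == i)%:R.
  by rewrite !mxE eqxx andbT.
have w0 : 0 <= w.
  apply: (@linear_term_ge0 w c 1 ltr01) => t /andP[t0 _].
  rewrite -fD subr_ge0 minl // => j; rewrite lD.
  by rewrite addr_ge0 ?mulr_ge0 ?ler0n ?(ltW t0) //; case/andP: (lB j).
split=> //; first by move: w0; rewrite /w !mxE subr_ge0.
(* When [l i 0 > 0], decreasing this coordinate is feasible as well. *)
have [->|lneq] := eqVneq (l i 0) 0; first by rewrite mul0r.
have lp : 0 < l i 0 by rewrite lt_neqAle eq_sym lneq.
suff : 0 <= - w.
  by rewrite oppr_ge0 => wle; rewrite (@le_anti _ _ w 0) ?mulr0 ?wle.
apply: (@linear_term_ge0 (- w) c _ lp) => t /andP[t0 tl].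
rewrite mulrN -mulNr -sqrrN -fD subr_ge0 minl // => j.
rewrite lD; have [->|_] := eqVneq j i; first by rewrite mulr1 subr_ge0 ltW.
by rewrite mulr0 addr0; case/andP: (lB j).
Qed.

Lemma kkt_dot_le m n (G : 'M[R]_(m, n)) b y l v w :
  kkt_multiplier G b y l -> vle v w -> dot l v <= dot l w.
Proof.
move=> kkt vw; rewrite !dotE; apply: ler_sum => i _.
by have [li0 _ _] := kkt i; rewrite ler_wpM2l.
Qed.

Lemma kkt_dot_eq m n (G : 'M[R]_(m, n)) b y l : kkt_multiplier G b y l ->
  dot l (G *m (y - G^T *m l)) = dot l b.
Proof.
move=> kkt; apply/esym/eqP; rewrite -subr_eq0 -dotNr -dotDr dotE.
by apply/eqP/big1 => i _; have [_ _ ->] := kkt i.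
Qed.

(** * From multipliers to the projection *)

(** For feasible [z], [<z - x, x - y> = <l, b - G z> >= 0]. The resulting Pythagorean inequality
    [pyth] gives both minimality of [x] and uniqueness, which pins down the choice made by
    [argmin]. *)
Lemma proj_kkt m n (G : 'M[R]_(m, n)) b y l : kkt_multiplier G b y l ->
  proj (polyhedron G b) y = y - G^T *m l.
Proof.
move=> kkt; set x := y - _.
have Cx : polyhedron G b x by move=> i; have [] := kkt i.
have pyth z : polyhedron G b z ->
    dot (x - y) (x - y) + dot (z - x) (z - x) <= dot (z - y) (z - y).
  move=> /(kkt_dot_le kkt); rewrite -(kkt_dot_eq kkt) -/x.
  rewrite -subr_ge0 -dotNr -dotDr -mulmxBr.
  rewrite -(opprB z x) mulmxN dotNr oppr_ge0.
  have -> : z - y = (z - x) + (x - y) by rewrite addrA subrK.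
  have -> : x - y = - (G^T *m l) by rewrite /x addrC addKr.
  rewrite dotC dot_mulmxl; move: (z - x) (G^T *m l) => d g.
  by rewrite !dot_linear (dotC g d); lra.
apply: xget_unique => [|z [Cz minz]].
  split=> // z Cz; rewrite ler_pM2l ?invr_gt0 // !sqr_enorm.
  by rewrite (le_trans _ (pyth z Cz)) // lerDl dot_ge0.
have := minz x Cx; rewrite ler_pM2l ?invr_gt0 // !sqr_enorm => zx.
apply/eqP; rewrite -subr_eq0 -dot_eq0 eq_le dot_ge0 andbT.
by have := pyth z Cz; lra.
Qed.

End EuclideanSpace.

Theorem lemma1 (R : realType) (m n : nat) (G : 'M[R]_(m, n))
    (b1 b2 : 'cV[R]_m) (G_full_row_rank : row_free G) (y : 'cV[R]_n) :
  enorm (proj (polyhedron G b1) y - proj (polyhedron G b2) y)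
    <= enorm (b1 - b2) / Num.sqrt (lambda_min (G *m G^T)).
Proof.
(* Without rows there is no eigenvalue and [lambda_min] is its default 0; but then [b1 = b2] and the
   left side vanishes. *)
have [m0|m0] := posnP m.
  have -> : b1 = b2.
    by apply/colP => -[i im]; exfalso; move: im; rewrite m0.
  by rewrite subrr {1}enormE dot0l sqrtr0 divr_ge0 ?enorm_ge0 ?sqrtr_ge0.
have lam0 := lambda_min_gram_gt0 G_full_row_rank m0.
have [|_ ray] := @lambda_minP R m (G *m G^T) _ m0.
  by rewrite trmx_mul trmxK.
set lam := lambda_min _ in lam0 ray *.
have [l1 kkt1] := exists_kkt_multiplier b1 y G_full_row_rank m0.
have [l2 kkt2] := exists_kkt_multiplier b2 y G_full_row_rank m0.
rewrite (proj_kkt kkt1) (proj_kkt kkt2).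
have := kkt_dot_eq kkt1; have := kkt_dot_eq kkt2.
set x1 := y - G^T *m l1; set x2 := y - G^T *m l2 => eq2 eq1.
have sat b l : kkt_multiplier G b y l -> vle (G *m (y - G^T *m l)) b.
  by move=> kkt i; have [] := kkt i.
(* Each multiplier is tested against the other point's feasibility; this bounds the cross terms of
   [<l2 - l1, G x1 - G x2>], while [eq1] and [eq2] evaluate the other two. *)
have le1 : dot l1 (G *m x2) <= dot l1 b2 := kkt_dot_le kkt1 (sat _ _ kkt2).
have le2 : dot l2 (G *m x1) <= dot l2 b1 := kkt_dot_le kkt2 (sat _ _ kkt1).
have x12 : x1 - x2 = G^T *m (l2 - l1).
  by rewrite /x1 /x2 mulmxBr opprB addrC addrA subrK.
have e2 : enorm (x1 - x2) ^+ 2 <= enorm (l2 - l1) * enorm (b1 - b2).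
  apply: le_trans (cauchy_schwarz _ _).
  rewrite sqr_enorm {1}x12 dot_mulmxl trmxK mulmxBr !dot_linear.
  lra.
have r0 : 0 < Num.sqrt lam by rewrite sqrtr_gt0.
have le_dual : Num.sqrt lam * enorm (l2 - l1) <= enorm (x1 - x2).
  have := ray (l2 - l1); rewrite -mulmxA dot_mulmxl -x12 -!sqr_enorm.
  rewrite -[X in X * _](sqr_sqrtr (ltW lam0)) -exprMn.
  by rewrite ler_pXn2r ?nnegrE ?mulr_ge0 ?enorm_ge0 ?sqrtr_ge0.
rewrite ler_pdivlMr //.
(* [e2] and [le_dual] chain to the goal multiplied by [enorm (x1 - x2)], which can be cancelled only
   when nonzero. *)
have [->|e0] := eqVneq (enorm (x1 - x2)) 0; first by rewrite mul0r enorm_ge0.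
have {}e0 : 0 < enorm (x1 - x2) by rewrite lt_neqAle eq_sym e0 enorm_ge0.
rewrite -(ler_pM2l e0).
have := ler_wpM2r (ltW r0) e2; have := ler_wpM2r (enorm_ge0 (b1 - b2)) le_dual.
lra.
Qed.
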